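(* Let $W_n$ denote the total number of weak left to right maxima, summed over all Dyck paths of semi-length $n$, and let $\mathrm{WTot}=\sum_{n\ge1}W_n z^{2n}$. Then, with $u$ the power series in $z$ defined by $u=\frac{1-2z^2-\sqrt{1-4z^2}}{2z^2}$ (so that $z^2=\frac{u}{(1+u)^2}$), \[ \mathrm{WTot}=\sum_{r=1}^\infty \frac{(1-u)u^r(1-u^2)}{(1-u^{1+r})(1-u^{2+r})}\left(1-r+(1+u)\sum_{i=1}^r\frac{1-u^{1+i}}{1-u^{2+i}}\right). \]
   Context: A Dyck path of semi-length $n$ is a lattice path from $(0,0)$ to $(2n,0)$ with $n$ up steps $(1,1)$ and $n$ down steps $(1,-1)$ never going below the $x$-axis. A peak is an up step immediately followed by a down step, and its height is the height of its top point. A weak left to right maximum is a peak whose height is greater than or equal to the heights of all peaks to its left. *)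

(* Defs.v *)
From HB Require Import structures.
From mathcomp Require Import all_boot all_order all_algebra.
From mathcomp Require Import boolp zify ring.

Set Implicit Arguments.
Unset Strict Implicit.
Unset Printing Implicit Defensive.

Import Order.TTheory GRing.Theory Num.Theory.
Local Open Scope ring_scope.

(* Formal power series over a field: [f n] is the coefficient of the n-th power
   of the variable. The record keeps the Cauchy product apart from the
   pointwise structure that MathComp puts on functions. *)
Record fps (R : Type) := Fps { coefs :> nat -> R }.

HB.instance Definition _ (R : Type) := gen_eqMixin (fps R).
HB.instance Definition _ (R : Type) := gen_choiceMixin (fps R).

Lemma fpsP (R : Type) (f g : fps R) : (forall n, f n = g n) -> f = g.
Proof. by case: f g => [f] [g] /= fg; congr Fps; apply/funext. Qed.

Section FpsRing.
Variable R : fieldType.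
Implicit Types f g h : fps R.

Definition fps_const (c : R) : fps R := Fps (fun n => if n == 0%N then c else 0).
Definition fps_add f g : fps R := Fps (fun n => f n + g n).
Definition fps_opp f : fps R := Fps (fun n => - f n).
Definition fps_mul f g : fps R := Fps (fun n => \sum_(i < n.+1) f i * g (n - i)%N).

Lemma fps_addA : associative fps_add.
Proof. by move=> f g h; apply: fpsP => n /=; rewrite addrA. Qed.
Lemma fps_addC : commutative fps_add.
Proof. by move=> f g; apply: fpsP => n /=; rewrite addrC. Qed.
Lemma fps_add0 : left_id (fps_const 0) fps_add.
Proof. by move=> f; apply: fpsP => n /=; rewrite if_same add0r. Qed.
Lemma fps_addN : left_inverse (fps_const 0) fps_opp fps_add.
Proof. by move=> f; apply: fpsP => n /=; rewrite if_same addNr. Qed.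

HB.instance Definition _ :=
  GRing.isZmodule.Build (fps R) fps_addA fps_addC fps_add0 fps_addN.

Lemma fps_mulE_poly f g n N : (n < N)%N ->
  fps_mul f g n = (\poly_(i < N) f i * \poly_(i < N) g i)`_n.
Proof.
move=> ltnN; rewrite coefM; apply: eq_bigr => i _.
rewrite !coef_poly (leq_ltn_trans _ ltnN) ?leq_ord //.
by rewrite (leq_ltn_trans _ ltnN) ?leq_subr.
Qed.

Lemma fps_mulC : commutative fps_mul.
Proof.
by move=> f g; apply: fpsP => n; rewrite !(@fps_mulE_poly _ _ n n.+1) // mulrC.
Qed.

Lemma fps_mulA : associative fps_mul.
Proof.
move=> f g h; apply: fpsP => n.
pose P (k : fps R) := \poly_(i < n.+1) k i.
have truncM (k l : fps R) m : (m < n.+1)%N -> (P (fps_mul k l))`_m = (P k * P l)`_m.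
  by move=> lt_mn; rewrite coef_poly lt_mn (@fps_mulE_poly _ _ m n.+1).
rewrite !(@fps_mulE_poly _ _ n n.+1) // -!/(P _).
transitivity ((P f * (P g * P h))`_n).
  rewrite !(coefM (P f)); apply: eq_bigr => i _.
  by rewrite truncM // ltnS leq_subr.
rewrite mulrA !(coefM _ (P h)); apply: eq_bigr => i _.
by rewrite truncM.
Qed.

Lemma fps_mul1 : left_id (fps_const 1) fps_mul.
Proof.
move=> f; apply: fpsP => n /=; rewrite big_ord_recl /= mul1r subn0 big1 ?addr0 //.
by move=> i _; rewrite mul0r.
Qed.

Lemma fps_mulDl : left_distributive fps_mul fps_add.
Proof.
move=> f g h; apply: fpsP => n /=; rewrite -big_split /=.
by apply: eq_bigr => i _; rewrite mulrDl.
Qed.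

Lemma fps_1neq0 : fps_const 1 != 0.
Proof.
by apply/eqP => /(congr1 (fun f => coefs f 0)) /= /eqP; rewrite oner_eq0.
Qed.

HB.instance Definition _ :=
  GRing.Zmodule_isComNzRing.Build (fps R)
    fps_mulA fps_mulC fps_mul1 fps_mulDl fps_1neq0.

Lemma coefs0 n : (0 : fps R) n = 0. Proof. by rewrite /= if_same. Qed.
Lemma coefs1 n : (1 : fps R) n = (n == 0%N)%:R. Proof. by case: n. Qed.
Lemma coefsD f g n : (f + g) n = f n + g n. Proof. by []. Qed.
Lemma coefsN f n : (- f) n = - f n. Proof. by []. Qed.
Lemma coefsB f g n : (f - g) n = f n - g n. Proof. by []. Qed.
Lemma coefsM f g n : (f * g) n = \sum_(i < n.+1) f i * g (n - i)%N.
Proof. by []. Qed.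
Lemma coefsM0 f g : (f * g) 0%N = f 0%N * g 0%N.
Proof. by rewrite coefsM big_ord1. Qed.
Lemma coefsMn f k n : (f *+ k) n = f n *+ k.
Proof. by elim: k => [|k IHk]; rewrite ?mulr0n ?coefs0 // !mulrS coefsD IHk. Qed.
Lemma coefs_sum I (r : seq I) (P : pred I) (F : I -> fps R) n :
  (\sum_(i <- r | P i) F i) n = \sum_(i <- r | P i) F i n.
Proof.
by elim/big_rec2: _ => [|i x y _ <-]; rewrite ?coefs0 ?coefsD.
Qed.

Lemma coefsX_small f k n : f 0%N = 0 -> (n < k)%N -> (f ^+ k) n = 0.
Proof.
move=> f0; elim: k n => // k IHk n lt_nk; rewrite exprS coefsM big1 // => i _.
have [i0|i_gt0] := posnP i; first by rewrite i0 f0 mul0r.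
by rewrite IHk ?mulr0 //; case: i i_gt0 => -[|i] //= lt_in _; lia.
Qed.

Definition fps_unit : pred (fps R) := fun f => f 0%N != 0.

(* c^-1 * (1 + h + h^2 + ...) with c the constant coefficient of f and
   f = c * (1 - h); only the powers up to n contribute to degree n. *)
Definition fps_geom f : fps R := 1 - fps_const (f 0%N)^-1 * f.
Definition fps_inv f : fps R :=
  if fps_unit f then
    fps_const (f 0%N)^-1 * Fps (fun n => (\sum_(k < n.+1) fps_geom f ^+ k) n)
  else f.

Lemma fps_constM a b : fps_const (a * b) = fps_const a * fps_const b.
Proof.
apply: fpsP => n; rewrite coefsM big_ord_recl /= subn0 big1 ?addr0 => [|i _].
  by case: ifP => // _; rewrite mulr0.
by rewrite mul0r.
Qed.

Lemma fps_mulVr : {in fps_unit, left_inverse 1 fps_inv *%R}.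
Proof.
move=> f f_unit; rewrite /fps_inv ifT //; move: f_unit; rewrite unfold_in /fps_unit => f0.
set c := f 0%N in f0 *; set S := Fps _; set h := fps_geom f in S *.
have h0 : h 0%N = 0.
  by rewrite /h /fps_geom coefsB coefs1 coefsM0 /= mulVf ?subrr.
have -> : fps_const c^-1 * S * f = (1 - h) * S.
  by rewrite /h /fps_geom opprB addrC subrK mulrAC.
apply: fpsP => n.
have SE m : (m <= n)%N -> S m = (\sum_(k < n.+1) h ^+ k) m.
  move=> le_mn; rewrite /S /= !coefs_sum -!(big_mkord xpredT (fun k => (h ^+ k) m)).
  rewrite [RHS](@big_cat_nat _ _ _ m.+1) //=.
  rewrite [X in _ = _ + X]big_nat_cond [X in _ = _ + X]big1 ?addr0 // => k.
  by rewrite andbT => /andP[lt_mk _]; apply: coefsX_small.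
have -> : ((1 - h) * S) n = ((1 - h) * \sum_(k < n.+1) h ^+ k) n.
  by rewrite !coefsM; apply: eq_bigr => i _; rewrite SE ?leq_subr.
have -> : (1 - h) * (\sum_(k < n.+1) h ^+ k) = 1 - h ^+ n.+1.
  by rewrite -[1 - h]opprB -[1 - h ^+ _]opprB subrX1 mulNr.
by rewrite coefsB (@coefsX_small _ n.+1) ?subr0.
Qed.

Lemma fps_unitPl f g : g * f = 1 -> fps_unit f.
Proof.
move=> gf1; apply/eqP => f0; move/(congr1 (fun k => coefs k 0%N))/eqP: gf1.
by rewrite coefsM0 f0 mulr0 coefs1 eq_sym oner_eq0.
Qed.

Lemma fps_inv_out : {in [predC fps_unit], fps_inv =1 id}.
Proof. by move=> f; rewrite !inE unfold_in /fps_inv => f0; rewrite ifN. Qed.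

HB.instance Definition _ :=
  GRing.ComNzRing_hasMulInverse.Build (fps R) fps_mulVr fps_unitPl fps_inv_out.

Lemma fps_unitE f : (f \is a GRing.unit) = (f 0%N != 0).
Proof. by []. Qed.

Definition fpsX : fps R := Fps (fun n => (n == 1%N)%:R).

Lemma coefsXnM f k n : (fpsX ^+ k * f) n = if (n < k)%N then 0 else f (n - k)%N.
Proof.
elim: k n => [|k IHk] n; first by rewrite mul1r subn0.
rewrite exprS -mulrA coefsM; case: n => [|n].
  by rewrite big_ord1 /= mul0r.
rewrite 2!big_ord_recl [X in X + _](_ : _ = 0) ?add0r; last exact: mul0r.
rewrite [X in X + _](_ : _ = (fpsX ^+ k * f) n); last first.
  by rewrite lift0 subSS subn0; exact: mul1r.
by rewrite big1 ?addr0 ?IHk // => i _; apply: mul0r.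
Qed.

(* Quotient by the k-th power of the variable, which is not a unit; the k
   lowest coefficients are dropped, so it is exact only when they vanish. *)
Definition fps_divXn (k : nat) f : fps R := Fps (fun n => f (n + k)%N).

Lemma fps_divXnK k f : (forall i, (i < k)%N -> f i = 0) ->
  fpsX ^+ k * fps_divXn k f = f.
Proof.
move=> fk; apply: fpsP => n; rewrite coefsXnM; case: ltnP => [/fk //|le_kn].
by rewrite /= subnK.
Qed.

Lemma fpsXn_inj k : injective (fun f => fpsX ^+ k * f).
Proof.
move=> f g /= fg; apply: fpsP => n; move/(congr1 (fun h => coefs h (n + k)%N)): fg.
by rewrite !coefsXnM ltnNge leq_addl /= addnK.
Qed.

(* For a series f with constant coefficient 1, the square root of f with
   constant coefficient 1; [sqrt_seq f n] lists its first n coefficients. *)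
Fixpoint sqrt_seq f (n : nat) : seq R :=
  if n is m.+1 then
    let s := sqrt_seq f m in
    rcons s (if m == 0%N then 1
             else (f m - \sum_(1 <= k < m) s`_k * s`_(m - k)) / 2)
  else [::].
Definition fps_sqrt f : fps R := Fps (fun n => (sqrt_seq f n.+1)`_n).

Lemma size_sqrt_seq f n : size (sqrt_seq f n) = n.
Proof. by elim: n => //= n IHn; rewrite size_rcons IHn. Qed.

Lemma nth_sqrt_seq f n k : (k < n)%N -> (sqrt_seq f n)`_k = fps_sqrt f k.
Proof.
elim: n => // n IHn; rewrite ltnS leq_eqVlt => /predU1P[-> //|lt_kn].
by rewrite /= nth_rcons size_sqrt_seq lt_kn IHn.
Qed.

Lemma fps_sqrt0 f : fps_sqrt f 0%N = 1.
Proof. by []. Qed.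

Lemma fps_sqrtS f n : fps_sqrt f n.+1 =
  (f n.+1 - \sum_(1 <= k < n.+1) fps_sqrt f k * fps_sqrt f (n.+1 - k)%N) / 2.
Proof.
rewrite {1}/fps_sqrt [LHS]/= nth_rcons size_rcons size_sqrt_seq ltnn eqxx /=.
congr ((_ - _) / _); apply: eq_big_nat => k /andP[k_gt0 lt_kn].
rewrite -[rcons _ _]/(sqrt_seq f n.+1) !nth_sqrt_seq //.
by rewrite ltn_subrL k_gt0.
Qed.

Lemma sqr_fps_sqrt f : 2 != 0 :> R -> f 0%N = 1 -> fps_sqrt f ^+ 2 = f.
Proof.
move=> two_neq0 f0; apply: fpsP => n; rewrite expr2 coefsM.
move: (fps_sqrt0 f) (fps_sqrtS f); case: (fps_sqrt f) => s /= s0 sS.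
case: n => [|n]; first by rewrite big_ord1 s0 mulr1 f0.
rewrite -(big_mkord xpredT (fun k => s k * s (n.+1 - k)%N)).
rewrite big_nat_recl // big_nat_recr //= subnn subn0 s0 mul1r mulr1.
rewrite -(big_add1 _ _ 0 n.+1 xpredT (fun k => s k * s (n.+1 - k)%N)).
by rewrite addrCA -mulr2n -[_ *+ 2]mulr_natr sS divfK // addrC subrK.
Qed.

(* S is the sum of the series F m + F m.+1 + ... in the topology of formal
   power series: every coefficient of the partial sums is eventually equal to
   that of S. *)
Definition fps_has_sum (m : nat) (F : nat -> fps R) (S : fps R) : Prop :=
  forall n, exists N, forall M, (N <= M)%N -> (\sum_(m <= r < M) F r) n = S n.

End FpsRing.

Arguments fpsX {R}.

(* A lattice path is its sequence of steps, [true] for up and [false] for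
   down; [height p i] is its ordinate at abscissa i. *)
Definition height (p : seq bool) (i : nat) : int :=
  (count_mem true (take i p))%:Z - (count_mem false (take i p))%:Z.

Definition dyck (n : nat) : {set (2 * n).-tuple bool} :=
  [set p : (2 * n).-tuple bool | [&& count_mem true p == n, count_mem false p == n
             & [forall i : 'I_(2 * n).+1, 0 <= height p i]]].

(* The peak at i consists of the steps i (up) and i.+1 (down), counted from 0;
   its top point has abscissa i.+1. *)
Definition is_peak (p : seq bool) (i : nat) : bool :=
  [&& (i.+1 < size p)%N, nth false p i & ~~ nth false p i.+1].

Definition peak_height (p : seq bool) (i : nat) : int := height p i.+1.

Definition weak_lr_max (p : seq bool) (i : nat) : bool :=
  is_peak p i &&
  [forall j : 'I_i, is_peak p j ==> (peak_height p j <= peak_height p i)].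

Definition nb_weak_lr_max (p : seq bool) : nat :=
  #|[set i : 'I_(size p) | weak_lr_max p i]|.

Definition W (n : nat) : nat := \sum_(p in dyck n) nb_weak_lr_max p.

Definition z : fps rat := fpsX.

Definition WTot : fps rat :=
  Fps (fun k => if (0 < k)%N && ~~ odd k then (W k./2)%:R else 0).

Lemma WTot_has_sum : fps_has_sum 1 (fun n => (W n)%:R * z ^+ (2 * n)) WTot.
Proof.
move=> k; exists k.+1 => M lt_kM; rewrite coefs_sum.
have termE n : ((W n)%:R * z ^+ (2 * n)) k = if k == (2 * n)%N then (W n)%:R else 0.
  rewrite mulrC coefsXnM coefsMn coefs1.
  by case: ltngtP => [||->]; rewrite ?subnn // => lt; rewrite subn_eq0 leqNgt lt mul0rn.
rewrite (eq_bigr _ (fun n _ => termE n)) [RHS]/=; case: ifP => [|k_odd].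
  move=> k_even; rewrite (bigD1_seq k./2) ?iota_uniq //=; last by rewrite mem_index_iota; lia.
  rewrite ifT; last lia.
  by rewrite big1 ?addr0 // => n n_neq; rewrite ifF //; lia.
rewrite big_nat big1 // => n n_gt0; rewrite ifF //; apply/negP => /eqP kE; lia.
Qed.

Definition u : fps rat :=
  fps_divXn 2 (1 - 2 * z ^+ 2 - fps_sqrt (1 - 4 * z ^+ 2)) / 2.

Lemma unit_fps_nat (n : nat) : (n.+1%:R : fps rat) \is a GRing.unit.
Proof. by rewrite fps_unitE coefsMn coefs1 pnatr_eq0. Qed.

Lemma coefs_1Bz2 (c : nat) :
  (((1 - c%:R * z ^+ 2) 0%N = 1) * ((1 - c%:R * z ^+ 2) 1%N = 0)
  * ((1 - c%:R * z ^+ 2) 2%N = - c%:R))%type.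
Proof.
by rewrite mulrC !coefsB !coefs1 !coefsXnM coefsMn coefs1 /= !subr0 sub0r.
Qed.

Lemma coefs_sqrt_1B4z2 : let s := fps_sqrt (1 - 4 * z ^+ 2) in
  ((s 0%N = 1) * (s 1%N = 0) * (s 2%N = - 2))%type.
Proof.
have s1 : fps_sqrt (1 - 4 * z ^+ 2) 1%N = 0.
  by rewrite fps_sqrtS coefs_1Bz2 big_geq // subrr mul0r.
by move=> s; rewrite /s fps_sqrt0 s1 fps_sqrtS coefs_1Bz2 big_nat1 s1 mul0r subr0.
Qed.

Lemma mul_z2_u : 2 * z ^+ 2 * u = 1 - 2 * z ^+ 2 - fps_sqrt (1 - 4 * z ^+ 2).
Proof.
rewrite -mulrA mulrCA /u [2 * (_ / 2)]mulrC divrK ?unit_fps_nat // fps_divXnK //.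
by case=> [|[|]] // _; rewrite coefsB coefs_1Bz2 coefs_sqrt_1B4z2 subrr.
Qed.

Lemma coefs_u0 : u 0%N = 0.
Proof.
have /(congr1 (fun f => coefs f 2)) := mul_z2_u.
rewrite -mulrA mulrCA coefsXnM coefsM0 coefsB coefs_1Bz2 coefs_sqrt_1B4z2 subrr.
by rewrite coefsMn coefs1 => /eqP; rewrite mulf_eq0 => /eqP.
Qed.

Lemma z2_u : z ^+ 2 = u / (1 + u) ^+ 2.
Proof.
have unit1u : 1 + u \is a GRing.unit by rewrite fps_unitE coefsD coefs_u0 coefs1.
apply: (mulIr (unitrX 2 unit1u)); rewrite divrK ?unitrX //.
have sqr_sqrt := @sqr_fps_sqrt rat (1 - 4 * z ^+ 2) isT (coefs_1Bz2 4).1.1.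
have sqrtE : fps_sqrt (1 - 4 * z ^+ 2) = 1 - 2 * z ^+ 2 - 2 * z ^+ 2 * u.
  by rewrite mul_z2_u subKr.
apply: (mulrI (unit_fps_nat 3)); apply: (@fpsXn_inj _ 2) => /=; rewrite -/z.
apply/eqP; rewrite -subr_eq0; move/eqP: sqr_sqrt; rewrite sqrtE -subr_eq0 => /eqP <-.
by apply/eqP; ring.
Qed.

(* Main.v *)
(** Cut a Dyck path at the top of a weak left to right maximum of height r: the
    left part is a path from 0 to r inside the strip [[0, r]], and the right part
    is a down step followed by a path from r - 1 to 0 above the axis. Their
    generating functions are [z^r (1-u) (1+u)^(r+1) / (1-u^(r+2))] and
    [z^r (1+u)^r], so the maxima of height r contribute
    [u^r (1-u^2) / (1-u^(r+2))]. Since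
    [(1-u) u^r / ((1-u^(r+1)) (1-u^(r+2))) = b_r - b_(r+1)] with
    [b_r = u^r / (1-u^(r+1))], summation by parts turns the double sum into this
    simple one, up to a remainder of order [u^(M+1)]. *)

Require Import Defs.
From mathcomp Require Import all_boot all_order all_algebra.
From mathcomp Require Import zify ring.

Import Order.TTheory GRing.Theory Num.Theory.
Local Open Scope ring_scope.

(** * Sums over words of a given length *)

Definition wsum (k : nat) (F : seq bool -> nat) : nat :=
  (\sum_(p : k.-tuple bool) F p)%N.

Lemma wsum0 F : wsum 0 F = F [::].
Proof.
rewrite /wsum (eq_bigr (fun=> F [::])) => [|p _]; last by rewrite tuple0.
by rewrite sum_nat_const card_tuple expn0 mul1n.
Qed.

Lemma wsumS k F :
  wsum k.+1 F = (wsum k (fun s => F (true :: s)) + wsum k (fun s => F (false :: s)))%N.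
Proof.
rewrite /wsum -(big_bool _ (fun b => \sum_(p : k.-tuple bool) F (b :: p)))%N pair_big /=.
rewrite (reindex (fun q : bool * k.-tuple bool => cons_tuple q.1 q.2)) //=.
exists (fun p : k.+1.-tuple bool => (thead p, behead_tuple p)) => [[b t] _|p _] /=.
  by congr pair; apply: val_inj.
by rewrite [RHS]tuple_eta; apply: val_inj.
Qed.

Lemma eq_wsum k F G : (forall s, size s = k -> F s = G s) -> wsum k F = wsum k G.
Proof. by move=> FG; apply: eq_bigr => p _; rewrite FG ?size_tuple. Qed.

(** Cutting at [m] is a bijection between words and pairs of words; this is the combinatorial form
    of one term of a Cauchy product. *)
Lemma wsum_cat m n F G :
  wsum (m + n) (fun s => F (take m s) * G (drop m s))%N = (wsum m F * wsum n G)%N.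
Proof.
elim: m F => [|m IHm] F.
  rewrite wsum0 /wsum big_distrr /=; apply: eq_bigr => p _.
  by rewrite take0 drop0.
by rewrite addSn !wsumS /= (IHm (fun s => F (true :: s))) (IHm (fun s => F (false :: s)))
           mulnDl.
Qed.

(** * Constrained walks and Dyck paths *)

(** Recursion on the first step moves the starting height [h] and fixes the end [e], which yields
    the recurrence of the generating functions. *)
Fixpoint walk (c : pred nat) (e h : nat) (p : seq bool) : bool :=
  c h && match p with
         | [::] => h == e
         | true :: q => walk c e h.+1 q
         | false :: q => (0 < h)%N && walk c e h.-1 q
         end.

Lemma height0 p : height p 0 = 0.
Proof. by rewrite /height take0. Qed.

Lemma heightS b p i : height (b :: p) i.+1 = (if b then 1 else - 1) + height p i.
Proof. by rewrite /height /=; case: b => /=; lia. Qed.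

Lemma height_step p i : (i < size p)%N ->
  height p i.+1 = height p i + (if nth false p i then 1 else - 1).
Proof.
elim: p i => // b p IHp [|i] lt_ip; first by rewrite heightS !height0 addrC.
by rewrite !heightS IHp // addrA.
Qed.

Lemma height_take p k i : (i <= k)%N -> height (take k p) i = height p i.
Proof. by move=> le_ik; rewrite /height take_takel. Qed.

Lemma height_drop p k i : height (drop k p) i = height p (k + i) - height p k.
Proof.
rewrite /height; have -> : take (k + i) p = take k p ++ take i (drop k p).
  by rewrite takeD.
by rewrite !count_cat; lia.
Qed.

(** Links the recursive form, suited to recurrences, with the form by heights, suited to cutting and
    to [dyck]. *)
Lemma walkP (c : pred nat) (e h : nat) p :
  reflect ((forall i, (i <= size p)%N ->
              0 <= h%:Z + height p i /\ c `|(h%:Z + height p i)%R|%N)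
           /\ h%:Z + height p (size p) = e)
          (walk c e h p).
Proof.
elim: p h => [|b p IHp] h /=.
  have nil0 i : h%:Z + height [::] i = h by rewrite /height /= addr0.
  apply: (iffP andP) => [[ch /eqP <-]|[ch]]; rewrite nil0.
    by split=> [i _|//]; rewrite ?addn0; split.
  by move=> [<-]; have [_] := ch 0%N isT; rewrite !addn0 => ->.
have step (m : nat) : m%:Z = h%:Z + (if b then 1 else - 1) ->
    (c h && walk c e m p) <->
    ((forall i, (i <= (size p).+1)%N ->
              0 <= h%:Z + height (b :: p) i /\ c `|(h%:Z + height (b :: p) i)%R|%N)
           /\ h%:Z + height (b :: p) (size p).+1 = e).
  move=> mE; rewrite heightS addrA -mE; split.
    case/andP=> ch /IHp [cp ep]; split=> // -[|i] le_i.
      by rewrite height0 addr0; split.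
    by rewrite heightS addrA -mE; apply: cp.
  move=> [cp ep]; apply/andP; split.
    by have [_] := cp 0%N isT; rewrite height0 addr0.
  apply/IHp; split=> // i le_i; have := cp i.+1 le_i.
  by rewrite heightS addrA -mE.
case: b step => step; first by apply/(iffP idP) => /(step h.+1); apply; lia.
case: h step => [|h] step /=.
  rewrite andbF; apply: ReflectF => -[cp _]; have := cp 1%N isT.
  by rewrite heightS height0 => -[].
by apply/(iffP idP) => /(step h); apply; lia.
Qed.

Lemma height_le p i : height p i <= i%:Z.
Proof.
apply: (@le_trans _ _ (count_mem true (take i p))%:Z); first by rewrite /height; lia.
rewrite lez_nat (leq_trans (count_size _ _)) //.
by rewrite size_take_min geq_minl.
Qed.

Lemma dyck_walk n (p : (2 * n).-tuple bool) : (p \in dyck n) = walk predT 0 0 p.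
Proof.
have tot : (count_mem true p + count_mem false p = 2 * n)%N.
  rewrite -[RHS](size_tuple p) -(count_predC (pred1 true)); congr addn.
  by apply: eq_count => -[].
have end_p : height p (2 * n) = (count_mem true p)%:Z - (count_mem false p)%:Z.
  by rewrite /height take_oversize ?size_tuple.
rewrite inE; apply/and3P/walkP => [[/eqP pt /eqP pf /forallP pos]|[pos]].
  rewrite size_tuple end_p pt pf subrr addr0; split=> // i; rewrite -ltnS => lt_i.
  by rewrite add0r; split=> //; apply: (pos (Ordinal lt_i)).
(* Total length [2 * n] and final height 0 leave [n] steps of each kind. *)
rewrite size_tuple end_p => eq0; split; [lia|lia|].
apply/forallP => i; have := pos i.
by rewrite size_tuple -ltnS ltn_ord add0r => /(_ isT)[].
Qed.

Lemma walk_odd c p : odd (size p) -> walk c 0 0 p = false.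
Proof.
move=> odd_p; apply/walkP => -[_]; rewrite add0r /height take_size.
have := count_predC (pred1 true) p.
rewrite (@eq_count _ (predC _) (pred1 false)); last by move=> -[].
move=> sz /subr0_eq [eq_tf]; move: odd_p.
by rewrite -sz eq_tf addnn odd_double.
Qed.

(** * Cutting a path at a weak maximum *)

(** The default [true] of [head] rejects the empty path, so the down step after the cut really
    exists. *)
Definition down_walk (r : nat) (p : seq bool) : bool :=
  ~~ head true p && walk predT 0 r p.

(* If an up step before i ended above the peak at i, the path would have to turn
   down before i, at a higher peak. *)
Lemma lr_max_height p i k : 0 <= height p i.+1 -> weak_lr_max p i ->
  (k <= i)%N ->
  height p k <= height p i.+1.
Proof.
move=> r_ge0 /andP[/and3P[lt_ip up_i _] /forallP lr_i].
have hi := height_step p i (ltnW lt_ip); rewrite up_i in hi.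
have climb d j : (j + d = i)%N -> (0 < j)%N -> nth false p j.-1 ->
    height p i.+1 < height p j -> False.
  elim: d j => [|d IHd] j; first by rewrite addn0 => -> _ _; lia.
  move=> jdE j_gt0 up_j high_j; have lt_jp : (j < size p)%N by lia.
  have := height_step p j lt_jp; case up_j1: (nth false p j) => hj.
    by apply: (IHd j.+1) => //; lia.
  have lt_ji : (j.-1 < i)%N by lia.
  have /implyP := lr_i (Ordinal lt_ji).
  rewrite /= /is_peak /peak_height prednK // lt_jp up_j up_j1 => /(_ isT); lia.
elim: k => [|k IHk] lt_ki; first by rewrite height0.
have lt_kp : (k < size p)%N by lia.
have := height_step p k lt_kp; have := IHk (ltnW lt_ki).
case up_k: (nth false p k) => le_k hk; last lia.
rewrite leNgt; apply/negP => high; apply: (climb (i - k.+1)%N k.+1) => //; lia.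
Qed.

(** The cut is at abscissa [i.+1], the top of the peak. Forwards, [lr_max_height] confines the left
    part to the strip; backwards, the strip bounds every earlier peak by [r]. *)
Lemma weak_lr_max_walk p i (r : nat) : (0 < r)%N ->
  [&& walk predT 0 0 p, weak_lr_max p i & height p i.+1 == r] =
  walk (leq^~ r) r 0 (take i.+1 p) && down_walk r (drop i.+1 p).
Proof.
move=> r_gt0; apply/and3P/andP.
  move=> [/walkP[pos_p end_p] lr_p /eqP hr].
  have [/and3P[lt_ip up_i down_i] _] := andP lr_p.
  have sz : size (take i.+1 p) = i.+1 by rewrite size_take lt_ip.
  split.
    apply/walkP; rewrite sz add0r height_take // hr; split=> // k le_ki.
    rewrite add0r height_take //.
    have [le_k0 _] := pos_p k (ltnW (leq_ltn_trans le_ki lt_ip)).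
    rewrite add0r in le_k0; split=> //.
    suff : height p k <= r by lia.
    move: le_ki; rewrite leq_eqVlt => /predU1P[->|]; first by rewrite hr.
    by rewrite ltnS -hr; apply: lr_max_height => //; rewrite hr.
  apply/andP; split.
    by rewrite -nth0 nth_drop addn0 (set_nth_default false).
  apply/walkP; split=> [k|]; rewrite height_drop hr addrC subrK size_drop.
    move=> le_k; have := pos_p (i.+1 + k)%N; rewrite add0r => -[]; first lia.
    by [].
  by rewrite subnKC ?(ltnW lt_ip) // -[LHS]add0r.
case=> /walkP[pos_t end_t] /andP[down_i /walkP[pos_d end_d]].
have lt_ip : (i.+1 < size p)%N.
  by rewrite ltnNge; apply: contra down_i => /drop_oversize ->.
have sz : size (take i.+1 p) = i.+1 by rewrite size_take lt_ip.
rewrite sz add0r height_take // in end_t.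
have le_r k : (k <= i.+1)%N -> 0 <= height p k <= r.
  move=> le_k; have := pos_t k; rewrite sz => /(_ le_k).
  rewrite add0r height_take // => -[pos le]; rewrite pos /=; lia.
(* A down step here would start at height [r + 1], outside the strip. *)
have up_i : nth false p i.
  have := height_step p i (ltnW lt_ip); have := le_r i (leqnSn i).
  by case: (nth false p i) => //; rewrite end_t; lia.
split; last by rewrite end_t.
  apply/walkP; split=> [k le_k|]; rewrite add0r.
    have [le_ki|lt_ik] := leqP k i.+1; first by have /andP[] := le_r k le_ki.
    have := pos_d (k - i.+1)%N; rewrite size_drop leq_sub2r // => /(_ isT).
    by rewrite height_drop end_t addrC subrK subnKC ?(ltnW lt_ik).
  by rewrite -end_d height_drop end_t addrC subrK size_drop subnKC ?(ltnW lt_ip).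
apply/andP; split.
  rewrite /is_peak lt_ip up_i (set_nth_default true) //.
  by move: down_i; rewrite -nth0 nth_drop addn0.
apply/forallP => j; apply/implyP => _; rewrite /peak_height end_t.
by have /andP[] := le_r j.+1 (ltnW (ltn_ord j)).
Qed.

(** Only [r] equal to the height of the peak contributes. It lies in the range: an up step from a
    nonnegative height ends at 1 or more, and no height exceeds the length. *)
Lemma weak_lr_maxE p i M : (size p < M)%N ->
  (walk predT 0 0 p && weak_lr_max p i : nat) =
  (\sum_(1 <= r < M) walk (leq^~ r) r 0 (take i.+1 p) * down_walk r (drop i.+1 p))%N.
Proof.
move=> lt_pM.
under eq_big_nat => r /andP[r_gt0 _] do rewrite mulnb -weak_lr_max_walk // andbA.
case: andP => [[w_p lr_p]|_]; last by rewrite big1.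
have [/and3P[lt_ip up_i _] _] := andP lr_p.
have hi := height_step p i (ltnW lt_ip); rewrite up_i in hi.
have [pos_i _] : 0 <= height p i /\ true.
  by case/walkP: w_p => /(_ i); rewrite add0r => /(_ (ltnW (ltnW lt_ip))).
have le_i := height_le p i.+1.
rewrite (bigD1_seq `|height p i.+1|%N) ?iota_uniq //=; last first.
  by rewrite mem_index_iota; lia.
rewrite big1 => [|r r_neq]; first by rewrite gez0_abs ?eqxx //; lia.
by case: eqP => // hr; rewrite hr absz_nat eqxx in r_neq.
Qed.

Lemma nb_weak_lr_maxE p : nb_weak_lr_max p = (\sum_(i < size p) weak_lr_max p i)%N.
Proof. by rewrite /nb_weak_lr_max cardsE -sum1_card big_mkcond. Qed.

(** * Generating functions of the two halves *)

Definition path_gf (c : pred nat) (e h : nat) : fps rat :=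
  Fps (fun k => (wsum k (walk c e h))%:R).
Definition down_gf (r : nat) : fps rat := Fps (fun k => (wsum k (down_walk r))%:R).

Lemma wsum_sum (I : Type) (s : seq I) (P : pred I) k (F : I -> seq bool -> nat) :
  wsum k (fun p => \sum_(i <- s | P i) F i p)%N = (\sum_(i <- s | P i) wsum k (F i))%N.
Proof. exact: exchange_big. Qed.

Lemma nb_weak_lr_max_gf k M : (k < M)%N ->
  (wsum k (fun p => walk predT 0 0 p * nb_weak_lr_max p)%N)%:R
  = (\sum_(1 <= r < M) path_gf (leq^~ r) r 0 * down_gf r) k.
Proof.
move=> lt_kM.
rewrite (@eq_wsum _ _ (fun p => \sum_(i < k) \sum_(1 <= r < M)
   walk (leq^~ r) r 0 (take i.+1 p) * down_walk r (drop i.+1 p)))%N; last first.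
  move=> p sz; rewrite nb_weak_lr_maxE big_distrr /= sz; apply: eq_bigr => i _.
  by rewrite mulnb (@weak_lr_maxE _ _ M) ?sz.
rewrite wsum_sum natr_sum coefs_sum.
under eq_bigr => i _ do rewrite wsum_sum natr_sum.
rewrite exchange_big; apply: eq_big_nat => r /andP[r_gt0 _].
(* The term with an empty left part vanishes because [r > 0]; the others, with left length [i.+1],
   match the positions [i < k]. *)
rewrite coefsM big_ord_recl [X in _ = X + _](_ : _ = 0); last first.
  by rewrite /= wsum0 /= eq_sym (gtn_eqF r_gt0) mul0r.
rewrite add0r; apply: eq_bigr => i _ /=.
rewrite /bump /= add1n -natrM -wsum_cat subnKC //.
Qed.

(** * Series in [u] and summation by parts *)

Lemma coefs_mul_zS (f : fps rat) n : (z * f) n.+1 = f n.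
Proof. by rewrite -[z]expr1 coefsXnM subn1. Qed.

Lemma coefs_mul_z0 (f : fps rat) : (z * f) 0%N = 0.
Proof. by rewrite -[z]expr1 coefsXnM. Qed.

Lemma unit_1Bu k : 1 - u ^+ k.+1 \is a GRing.unit.
Proof.
by rewrite fps_unitE coefsB coefs1 exprS coefsM0 coefs_u0 mul0r subr0.
Qed.

Lemma unit_1Du : 1 + u \is a GRing.unit.
Proof. by rewrite fps_unitE coefsD coefs_u0 coefs1. Qed.

Lemma mul_z2_sqr : z ^+ 2 * (1 + u) ^+ 2 = u.
Proof. by rewrite z2_u divrK ?unitrX ?unit_1Du. Qed.

Lemma coefs_uX_small k n f : (n < k)%N -> (u ^+ k * f) n = 0.
Proof.
move=> lt_nk; rewrite coefsM big1 // => i _.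
by rewrite coefsX_small ?mul0r ?coefs_u0 // (leq_ltn_trans (leq_ord i)).
Qed.

(** The last factor of the summand in the theorem, named so that its increments can be used. *)
Definition bracket (r : nat) : fps rat :=
  1 - r%:R + (1 + u) * \sum_(1 <= i < r.+1) (1 - u ^+ (1 + i)) / (1 - u ^+ (2 + i)).

(** With [b_r = u^r / (1 - u^(r+1))], the increment of [bracket] at [r] times [b_r] is
    [u^r / (1 - u^(r+2)) - b_r + b_(r+1)], and the last two terms telescope. The remainder is the
    boundary term at [b_(M+1)]. *)
Lemma abel_summation M :
  \sum_(1 <= r < M.+1) (1 - u) * u ^+ r * (1 - u ^+ 2)
         / ((1 - u ^+ (1 + r)) * (1 - u ^+ (2 + r))) * bracket r
  = \sum_(1 <= r < M.+1) u ^+ r * (1 - u ^+ 2) / (1 - u ^+ (2 + r))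
    + u ^+ M.+1 * ((1 - u ^+ 2) / (1 - u ^+ M.+2) * (1 - bracket M)).
Proof.
elim: M => [|M IHM].
  by rewrite !big_geq // /bracket big_geq // mulr0 addr0 subr0 subrr !mulr0 addr0.
rewrite big_nat_recr //= IHM [in RHS]big_nat_recr //= -!addrA; congr (_ + _).
have -> : bracket M.+1 = bracket M - 1 + (1 + u) * ((1 - u ^+ M.+2) / (1 - u ^+ M.+3)).
  by rewrite /bracket [in LHS]big_nat_recr //= mulrDr !addrA !add1n -natr1; ring.
rewrite !add1n (_ : (2 + M.+1 = M.+3)%N) // invrM ?unit_1Bu //.
set S := bracket M.
have := mulVr (unit_1Bu M.+1); have := mulVr (unit_1Bu M.+2).
set b := (1 - u ^+ M.+2)^-1; set c := (1 - u ^+ M.+3)^-1.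
rewrite !(exprS u M.+2) !(exprS u M.+1); set x := u ^+ M.+1 => cE bE.
apply/eqP; rewrite -subr_eq0; apply/eqP.
(* The difference is a combination of the two defects [b * (1 - u * x) - 1] and
   [c * (1 - u * (u * x)) - 1], both zero, so [ring] needs no division. *)
transitivity ((1 - u ^+ 2) * x *
   ((S - 1) * (b * (c * (1 - u * (u * x)) - 1) - u * c * (b * (1 - u * x) - 1))
    + (1 + u) * c * ((1 - u) * c * (b * (1 - u * x) - 1)
                     + (c * (1 - u * (u * x)) - 1)))).
  by ring.
by rewrite bE cE !subrr !(mulr0, subr0, addr0).
Qed.

(** * The total as a sum over heights, and closed forms *)

Lemma WTot_gf k M : (k < M)%N ->
  WTot k = (\sum_(1 <= r < M) path_gf (leq^~ r) r 0 * down_gf r) k.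
Proof.
move=> lt_kM; rewrite -nb_weak_lr_max_gf //=; case: ifP => [/andP[_ even_k]|].
  have kE : k = (2 * k./2)%N by lia.
  congr (_%:R); rewrite [in RHS]kE /wsum /W big_mkcond /=; apply: eq_bigr => p _.
  by rewrite dyck_walk; case: walk; rewrite ?mul1n.
(* What remains is degree 0, where the empty path has no peak, and odd degrees, where no path
   returns to the axis. *)
move=> k0_odd; rewrite (@eq_wsum _ _ (fun=> 0%N)).
  by rewrite /wsum big1.
move=> s sz; rewrite nb_weak_lr_maxE sz.
have [k0|k_gt0] := posnP k; first by rewrite k0 big_ord0 muln0.
by rewrite walk_odd ?sz //; move: k0_odd; rewrite k_gt0 /= => /negbFE.
Qed.

Lemma path_gf_rec (c : pred nat) e h : c h ->
  path_gf c e h = (h == e)%:R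
    + z * (path_gf c e h.+1 + (if h is h'.+1 then path_gf c e h' else 0)).
Proof.
move=> ch; apply: fpsP => -[|k]; rewrite coefsD.
  rewrite coefs_mul_z0 addr0 /= wsum0 /= ch.
  by case: eqP => _; rewrite ?coefs0 ?coefs1.
rewrite coefs_mul_zS [X in X + _](_ : _ = 0); last first.
  by case: eqP => _; rewrite ?coefs0 ?coefs1.
rewrite add0r coefsD /= wsumS natrD /= ch; congr (_ + _).
by case: h ch => [|h] _ //=; rewrite if_same /wsum big1.
Qed.

Lemma path_gf_out (c : pred nat) e h : ~~ c h -> path_gf c e h = 0.
Proof.
move=> ch; apply: fpsP => k; rewrite coefs0 /= /wsum big1 // => p _.
by case: (tval p) => [|[] q] /=; rewrite (negbTE ch).
Qed.

Lemma down_gfE r : (0 < r)%N -> down_gf r = z * path_gf predT 0 r.-1.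
Proof.
move=> r_gt0; apply: fpsP => -[|k].
  by rewrite coefs_mul_z0 /= wsum0.
rewrite coefs_mul_zS /= wsumS [X in (X + _)%N](_ : _ = 0%N); last first.
  by rewrite /wsum big1.
by rewrite add0n; congr (_%:R); apply: eq_wsum => s _; rewrite /down_walk /= r_gt0.
Qed.

(** [1 + u] is the Catalan series [C = 1 + z^2 C^2], so the right side obeys the first-step
    recurrence of [path_gf]. The factor [z] there lets induction on the degree, for all [h] at once,
    identify the two. *)
Lemma path_gf_catalan h : path_gf predT 0 h = z ^+ h * (1 + u) ^+ h.+1.
Proof.
apply: fpsP => k; elim/ltn_ind: k h => k IHk h.
have uE : 1 + u = 1 + z ^+ 2 * (1 + u) ^+ 2 by rewrite mul_z2_sqr.
pose F h := z ^+ h * (1 + u) ^+ h.+1.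
have FE : F h = (h == 0%N)%:R + z * (F h.+1 + (if h is h'.+1 then F h' else 0)).
  rewrite /F; case: h => [|h] /=; first by rewrite expr0 mul1r {1}uE; ring.
  by rewrite [in LHS](exprSr (1 + u)) {2}uE !exprS; ring.
rewrite path_gf_rec // -/(F h) FE !coefsD; congr (_ + _).
case: k IHk => [|k] IHk; first by rewrite !coefs_mul_z0.
rewrite !coefs_mul_zS !coefsD IHk //; congr (_ + _).
by case: h FE => // h _; rewrite IHk.
Qed.

(* Solving the strip recurrence downwards from its top vertex r: the ratios
   [(1 - u^(k+1)) / ((1 - u) (1 + u)^k)] are the continuants
   [P_0 = P_1 = 1], [P_(k+1) = P_k - z^2 P_(k-1)] expressed through u. *)
Lemma path_gf_strip r : (0 < r)%N ->
  path_gf (leq^~ r) r 0 * (1 - u ^+ r.+2) = z ^+ r * (1 - u) * (1 + u) ^+ r.+1.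
Proof.
move=> r_gt0.
have predE (X : nat -> fps rat) : (if r is r'.+1 then X r' else 0) = X r.-1.
  by case: r r_gt0.
pose A h := path_gf (leq^~ r) r h.
have top : A r = 1 + z * A r.-1.
  by rewrite /A path_gf_rec // eqxx path_gf_out ?ltnn // add0r predE.
(* Below the top the recurrence is homogeneous, so every [A h] is a multiple of [A 0]; it has order
   two, so two consecutive heights are carried. *)
have low h : (h < r)%N -> (1 - u) * (1 + u) ^+ h * z ^+ h * A h = (1 - u ^+ h.+1) * A 0
   /\ (1 - u) * (1 + u) ^+ h.+1 * z ^+ h.+1 * A h.+1 = (1 - u ^+ h.+2) * A 0.
  have bot : A 0%N = z * A 1%N.
    by rewrite {1}/A path_gf_rec // (ltn_eqF r_gt0) add0r addr0.
  elim: h => [|h IHh] lt_hr.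
    split; first by rewrite !expr0 expr1; ring.
    by rewrite [in RHS]bot; ring.
  have [IH0 IH1] := IHh (ltnW lt_hr); split=> //.
  have rec : z * A h.+2 = A h.+1 - z * A h.
    by rewrite {2}/A path_gf_rec ?(ltnW lt_hr) // (ltn_eqF lt_hr) add0r /A; ring.
  transitivity ((1 + u) * ((1 - u) * (1 + u) ^+ h.+1 * z ^+ h.+1 * A h.+1)
     - z ^+ 2 * (1 + u) ^+ 2 * ((1 - u) * (1 + u) ^+ h * z ^+ h * A h)).
    transitivity ((1 - u) * (1 + u) ^+ h.+2 * z ^+ h.+1 * (z * A h.+2)).
      by rewrite [in LHS](exprS z); ring.
    by rewrite rec !exprS; ring.
  by rewrite IH0 IH1 mul_z2_sqr !exprS; ring.
have lt_r1 : (r.-1 < r)%N by rewrite ltn_predL.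
have := low r.-1 lt_r1; rewrite (prednK r_gt0) => -[Er1 Er].
(* The top equation carries the constant 1 of the empty path, and this fixes [A 0]. *)
have E : (1 - u) * (1 + u) ^+ r.+1 * z ^+ r * A r
   = (1 - u) * (1 + u) ^+ r.+1 * z ^+ r
     + z ^+ 2 * (1 + u) ^+ 2 * ((1 - u) * (1 + u) ^+ r.-1 * z ^+ r.-1 * A r.-1).
  by rewrite top -(prednK r_gt0) /= !exprS; ring.
rewrite Er1 mul_z2_sqr in E.
rewrite -/(A 0%N).
transitivity ((1 + u) * ((1 - u ^+ r.+1) * A 0%N) - u * ((1 - u ^+ r) * A 0%N)).
  by rewrite !exprS; ring.
rewrite -Er; transitivity ((1 - u) * (1 + u) ^+ r.+1 * z ^+ r * A r
   - u * ((1 - u ^+ r) * A 0%N)); first by rewrite !exprS; ring.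
by rewrite E; ring.
Qed.

(** The powers of [z] and [1 + u] pair up into [(z^2 (1+u)^2)^r = u^r]; one factor [1 + u] is left
    to turn [1 - u] into [1 - u^2]. *)
Lemma path_down_gf r : (0 < r)%N ->
  path_gf (leq^~ r) r 0 * down_gf r = u ^+ r * (1 - u ^+ 2) / (1 - u ^+ (2 + r)).
Proof.
move=> r_gt0; apply: (mulIr (unit_1Bu r.+1)); rewrite divrK ?unit_1Bu //.
rewrite mulrAC path_gf_strip // down_gfE // path_gf_catalan prednK //.
transitivity ((z ^+ 2 * (1 + u) ^+ 2) ^+ r * (1 - u ^+ 2)); last first.
  by rewrite mul_z2_sqr.
case: r r_gt0 => // r _; rewrite exprMn -!exprM !mul2n -!addnn !exprD !exprS /=; ring.
Qed.

Theorem theorem7 :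
  fps_has_sum 1
    (fun r : nat =>
       (1 - u) * u ^+ r * (1 - u ^+ 2)
         / ((1 - u ^+ (1 + r)) * (1 - u ^+ (2 + r)))
       * (1 - r%:R
          + (1 + u) * \sum_(1 <= i < r.+1) (1 - u ^+ (1 + i)) / (1 - u ^+ (2 + i))))
    WTot.
Proof.
(* After the shift [k <= M]: the remainder, a multiple of [u^(M+1)], is zero in degree [k], and
   paths of length [k] have no maximum above [M]. *)
move=> k; exists k.+1 => -[//|M] lt_kM.
rewrite abel_summation (WTot_gf _ _ lt_kM) coefsD coefs_uX_small // addr0.
by congr coefs; apply: eq_big_nat => r /andP[r_gt0 _]; rewrite path_down_gf.
Qed.
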